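(* Let $\mathcal{F}$ be a factorization of $\Delta^2$ in $B_3$ each of whose factors is a positive half-twist or the square of a positive half-twist. Then $\mathcal{F}$ is Hurwitz equivalent to the standard factorization with the same number of factors of each type as $\mathcal{F}$, i.e. to the one of the following factorizations of $\Delta^2$ having the same number of positive half-twists and the same number of squares of positive half-twists as $\mathcal{F}$: $(\sigma_1,\sigma_2,\sigma_1,\sigma_1,\sigma_2,\sigma_1)$ (no squares); $(\sigma_1^2,\sigma_2,\sigma_1,\sigma_1,\sigma_2)$ (one square); $(\sigma_1^2,\sigma_2,\sigma_1^2,\sigma_2)$ (two squares); $(\sigma_1^2,\sigma_1^{-1}\sigma_2^2\sigma_1,\sigma_2^2)$ (three squares).
   Context: $B_3=\langle\sigma_1,\sigma_2:\sigma_1\sigma_2\sigma_1=\sigma_2\sigma_1\sigma_2\rangle$ and $\Delta=\sigma_1\sigma_2\sigma_1$; $\Delta^2$ is central in $B_3$. A positive half-twist is a conjugate of $\sigma_1$ in $B_3$. The type of a factor that is the $n$th power of a positive half-twist ($n\ge 1$) is $n$. A factorization of $g$ in a group $G$ is a tuple $(g_1,\dots,g_m)$ of elements of $G$ with $g=g_1\cdots g_m$. A Hurwitz move replaces adjacent factors $(g_j,g_{j+1})$ by $(g_jg_{j+1}g_j^{-1},g_j)$ or by $(g_{j+1},g_{j+1}^{-1}g_jg_{j+1})$. Two factorizations of a central element are Hurwitz equivalent if they are related by a finite sequence of Hurwitz moves and global conjugations $(g_1,\dots,g_m)\mapsto(hg_1h^{-1},\dots,hg_mh^{-1})$, $h\in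 G$. *)

(* Defs.v *)
From HB Require Import structures.
From mathcomp Require Import all_boot.
From mathcomp Require Import boolp.
From Stdlib Require Import Relation_Operators.

Set Implicit Arguments.
Unset Strict Implicit.
Unset Printing Implicit Defensive.

Local Open Scope quotient_scope.

(* A letter (i, e) stands for sigma_1 (i = false) or sigma_2 (i = true), and
   for the inverse of that generator if e = true. *)
Definition letter : Type := (bool * bool)%type.
Definition word : Type := seq letter.

Definition linv (x : letter) : letter := (x.1, ~~ x.2).
Definition winv (w : word) : word := rev (map linv w).

(* The smallest congruence on words generated by free cancellation and by the
   relation sigma_1 sigma_2 sigma_1 = sigma_2 sigma_1 sigma_2. *)
Inductive braid_eq : word -> word -> Prop :=
| braid_eq_refl w : braid_eq w w
| braid_eq_sym u v : braid_eq u v -> braid_eq v u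
| braid_eq_trans u v w : braid_eq u v -> braid_eq v w -> braid_eq u w
| braid_eq_cat u u' v v' :
    braid_eq u u' -> braid_eq v v' -> braid_eq (u ++ v) (u' ++ v')
| braid_eq_cancel x : braid_eq [:: x; linv x] [::]
| braid_eq_braid :
    braid_eq [:: (false, false); (true, false); (false, false)]
             [:: (true, false); (false, false); (true, false)].

Definition braid_rel (u v : word) : bool := `[< braid_eq u v >].

Lemma braid_rel_refl : reflexive braid_rel.
Proof. by move=> w; apply/asboolP; exact: braid_eq_refl. Qed.

Lemma braid_rel_sym : symmetric braid_rel.
Proof. by move=> u v; apply/asboolP/asboolP; exact: braid_eq_sym. Qed.

Lemma braid_rel_trans : transitive braid_rel.
Proof.
move=> v u w /asboolP uv /asboolP vw; apply/asboolP.
exact: braid_eq_trans uv vw.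
Qed.

Canonical braid_equiv :=
  EquivRel braid_rel braid_rel_refl braid_rel_sym braid_rel_trans.

Definition B3 : Type := {eq_quot braid_equiv}.
HB.instance Definition _ := Choice.on B3.
HB.instance Definition _ := EqQuotient.on B3.

Definition B3_of_word (w : word) : B3 := \pi_B3 w.

Lemma B3_of_wordP (u v : word) : B3_of_word u = B3_of_word v <-> braid_eq u v.
Proof.
split; first by move=> /eqmodP /asboolP.
by move=> uv; apply/eqmodP/asboolP.
Qed.

Lemma B3_of_wordK (x : B3) : B3_of_word (repr x) = x.
Proof. exact: reprK. Qed.

Lemma B3_wordP (x : B3) : exists w, x = B3_of_word w.
Proof. by exists (repr x); rewrite B3_of_wordK. Qed.

Lemma linvK : involutive linv.
Proof. by case=> i e; rewrite /linv /= negbK. Qed.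

Lemma winvK : involutive winv.
Proof.
by move=> w; rewrite /winv map_rev revK -map_comp map_id_in // => x _; exact: linvK.
Qed.

Lemma braid_eq_mulwV w : braid_eq (w ++ winv w) [::].
Proof.
elim: w => [|x w IHw]; first exact: braid_eq_refl.
rewrite /winv map_cons rev_cons -cats1 catA -/(winv w).
apply: braid_eq_trans (braid_eq_cancel x).
apply: (@braid_eq_cat (x :: (w ++ winv w)) [:: x]); last exact: braid_eq_refl.
rewrite -cat1s -[X in braid_eq _ X]cats0.
by apply: braid_eq_cat => //; exact: braid_eq_refl.
Qed.

Lemma braid_eq_mulVw w : braid_eq (winv w ++ w) [::].
Proof. by rewrite -{2}(winvK w); exact: braid_eq_mulwV. Qed.

Lemma braid_eq_inv u v : braid_eq u v -> braid_eq (winv u) (winv v).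
Proof.
move=> uv; apply: (@braid_eq_trans _ (winv u ++ (v ++ winv v))).
  rewrite -[X in braid_eq X]cats0; apply: braid_eq_cat; first exact: braid_eq_refl.
  exact/braid_eq_sym/braid_eq_mulwV.
apply: (@braid_eq_trans _ (winv u ++ (u ++ winv v))).
  apply: braid_eq_cat; first exact: braid_eq_refl.
  by apply: braid_eq_cat; [exact: braid_eq_sym | exact: braid_eq_refl].
rewrite catA -[X in braid_eq _ X]cat0s.
by apply: braid_eq_cat; [exact: braid_eq_mulVw | exact: braid_eq_refl].
Qed.

Definition B3_one : B3 := B3_of_word [::].
Definition B3_mul (x y : B3) : B3 := B3_of_word (repr x ++ repr y).
Definition B3_inv (x : B3) : B3 := B3_of_word (winv (repr x)).

Lemma repr_B3_of_word w : braid_eq (repr (B3_of_word w)) w.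
Proof. by apply/B3_of_wordP; rewrite B3_of_wordK. Qed.

Lemma B3_of_word_cat u v :
  B3_of_word (u ++ v) = B3_mul (B3_of_word u) (B3_of_word v).
Proof.
apply/B3_of_wordP/braid_eq_sym.
by apply: braid_eq_cat; exact: repr_B3_of_word.
Qed.

Lemma B3_of_word_inv w : B3_of_word (winv w) = B3_inv (B3_of_word w).
Proof. by apply/B3_of_wordP/braid_eq_sym/braid_eq_inv/repr_B3_of_word. Qed.

Lemma B3_mulA : associative B3_mul.
Proof.
move=> x y z.
have [[u ->] [v ->] [w ->]] := And3 (B3_wordP x) (B3_wordP y) (B3_wordP z).
by rewrite -!B3_of_word_cat catA.
Qed.

Lemma B3_mul1 : left_id B3_one B3_mul.
Proof. by move=> x; have [u ->] := B3_wordP x; rewrite -B3_of_word_cat. Qed.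

Lemma B3_mulr1 : right_id B3_one B3_mul.
Proof.
by move=> x; have [u ->] := B3_wordP x; rewrite -B3_of_word_cat cats0.
Qed.

Lemma B3_mulV : left_inverse B3_one B3_inv B3_mul.
Proof.
move=> x; have [u ->] := B3_wordP x; rewrite -B3_of_word_inv -B3_of_word_cat.
exact/B3_of_wordP/braid_eq_mulVw.
Qed.

Lemma B3_mulrV : right_inverse B3_one B3_inv B3_mul.
Proof.
move=> x; have [u ->] := B3_wordP x; rewrite -B3_of_word_inv -B3_of_word_cat.
exact/B3_of_wordP/braid_eq_mulwV.
Qed.

HB.instance Definition _ :=
  isGroup.Build B3 B3_mulA B3_mul1 B3_mulr1 B3_mulV B3_mulrV.

Local Open Scope group_scope.

Lemma B3_of_wordM u v : B3_of_word (u ++ v) = B3_of_word u * B3_of_word v.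
Proof. exact: B3_of_word_cat. Qed.

Lemma B3_of_wordV w : B3_of_word (winv w) = (B3_of_word w)^-1.
Proof. exact: B3_of_word_inv. Qed.

Definition sigma1 : B3 := B3_of_word [:: (false, false)].
Definition sigma2 : B3 := B3_of_word [:: (true, false)].

Lemma braid_relation : sigma1 * sigma2 * sigma1 = sigma2 * sigma1 * sigma2.
Proof.
by rewrite /sigma1 /sigma2 -!B3_of_wordM; apply/B3_of_wordP; exact: braid_eq_braid.
Qed.

Lemma B3_universal (G : groupType) (a b : G) :
  a * b * a = b * a * b ->
  exists f : B3 -> G,
    [/\ {morph f : x y / x * y}, f sigma1 = a & f sigma2 = b].
Proof.
move=> aba.
pose lev (x : letter) : G :=
  let g := if x.1 then b else a in if x.2 then g^-1 else g.
pose ev (w : word) : G := foldr (fun x g => lev x * g) 1 w.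
have evcat u v : ev (u ++ v) = ev u * ev v.
  by elim: u => [|x u /= ->]; rewrite ?mul1g ?mulgA.
have evE u v : braid_eq u v -> ev u = ev v.
  elim=> {u v} [//|u v _ -> //|u v w _ -> _ -> //|u u' v v' _ uu' _ vv'|[i e]|].
  - by rewrite !evcat uu' vv'.
  - by rewrite /ev /lev /= mulg1; case: e; rewrite /= ?mulVg ?mulgV.
  - by rewrite /ev /lev /= !mulg1 !mulgA.
have evr w : ev (repr (B3_of_word w)) = ev w by apply/evE/repr_B3_of_word.
exists (fun x => ev (repr x)); split=> [x y||]; last 2 first.
- by rewrite evr /ev /lev /= mulg1.
- by rewrite evr /ev /lev /= mulg1.
by rewrite evr evcat.
Qed.

Definition Delta : B3 := sigma1 * sigma2 * sigma1.

Definition half_twist (g : B3) : Prop := exists h : B3, g = h * sigma1 * h^-1.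

Definition has_type (n : nat) (g : B3) : Prop :=
  exists2 h : B3, half_twist h & g = h ^+ n.

Definition num_of_type (n : nat) (F : seq B3) : nat :=
  count (fun g => `[< has_type n g >]) F.

Section Hurwitz.
Variable G : groupType.
Implicit Types (g h : G) (F : seq G).

Definition factorization g F : Prop := g = \prod_(x <- F) x.

Inductive hurwitz_step : seq G -> seq G -> Prop :=
| hurwitz_left s t g h :
    hurwitz_step (s ++ [:: g, h & t]) (s ++ [:: g * h * g^-1, g & t])
| hurwitz_right s t g h :
    hurwitz_step (s ++ [:: g, h & t]) (s ++ [:: h, h^-1 * g * h & t])
| hurwitz_conj h F : hurwitz_step F [seq h * g * h^-1 | g <- F].

(* The inverse of a step is again a step, so this is an equivalence relation. *)
Definition hurwitz_equiv : seq G -> seq G -> Prop :=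
  clos_refl_trans (seq G) hurwitz_step.

End Hurwitz.

Definition standard_factorizations : seq (seq B3) :=
  [:: [:: sigma1; sigma2; sigma1; sigma1; sigma2; sigma1];
      [:: sigma1 ^+ 2; sigma2; sigma1; sigma1; sigma2];
      [:: sigma1 ^+ 2; sigma2; sigma1 ^+ 2; sigma2];
      [:: sigma1 ^+ 2; sigma1^-1 * sigma2 ^+ 2 * sigma1; sigma2 ^+ 2] ].

Definition standard_of_same_types (F S : seq B3) : Prop :=
  [/\ S \in standard_factorizations,
      num_of_type 1 S = num_of_type 1 F
    & num_of_type 2 S = num_of_type 2 F].

(* Main.v *)
Require Import Defs.
From mathcomp Require Import all_boot.
From mathcomp Require Import boolp ssrZ zify.
From Stdlib Require Import Relation_Operators ZArith Lia.
From Stdlib Require List.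

Set Implicit Arguments.
Unset Strict Implicit.

Local Open Scope group_scope.

Local Arguments Z.add : simpl never.
Local Arguments Z.sub : simpl never.
Local Arguments Z.mul : simpl never.
Local Arguments Z.opp : simpl never.

(** The braid group acts on [Z^2] through [SL_2(Z)]: a positive half-twist
  [g sigma1 g^-1] acts as the transvection [w |-> w - det(v, w) v] along
  [v = g e1], and [Delta^2] acts as [-1].  The proof turns factorizations of
  [Delta^2] into lists of pairs (vector up to sign, exponent), shows that after
  a global conjugation only finitely many lists occur, and compares those with
  the standard ones by computation.

  Finiteness comes from rotation.  The action lifts to directions in the plane
  together with a count of full turns, that is, to the universal cover of the
  circle of directions.  It preserves the order of that line, a positive
  half-twist moves no direction backwards, and [Delta^2] is the half-turn.
  Hence if [Delta^2 = g h] where [g] and [h] are products of positive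
  half-twists, then [g] turns every direction by an angle between 0 and pi:
  the quadratic form [det(v, g v)] is nonnegative ([det_prefix_ge0]).  Any two
  factors of a factorization can be made its first two without being altered;
  taking for [g] their product, a product of powers [m] and [n] of the
  transvections along [a] and [b], the discriminant of the form gives
  [m n det(a, b)^2 <= 4] ([twist_pair_bound]).

  The factors cannot all have parallel vectors, since [Delta^2] would then fix
  one of these vectors.  Two factors with nonparallel vectors are moved to the
  front, and a conjugation puts their vectors in one of the positions
  [(1,0), (0,1)] or [(1,0), (1,2)] ([moves_to_fronts]).  The bounds against
  these two confine every other vector to eight possibilities up to sign
  ([box_normv]); as the exponents add up to the degree 6 of [Delta^2], finitely
  many lists remain, of which 85 have product [-1].

  On lists, Hurwitz moves and conjugations act by matrices.  Greedily moving
  down a suitable ranking brings each of the 85 lists and each of the four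
  standard ones to one of four normal forms ([normal_form_candidates],
  [normal_form_standard]).  To return from lists to braids it remains to know
  that a half-twist is determined by its vector ([half_twist_vactE]): the
  Euclidean algorithm builds from a vector a braid, equivariantly under the
  braid group, and its value at [(1,0)] is [sigma1]. *)

(** * The braid group and its actions *)

Lemma B3_of_letter i e :
  B3_of_word [:: (i, e)] =
    let s := if i then sigma2 else sigma1 in if e then s^-1 else s.
Proof. by case: i e => [] [] //=; rewrite -B3_of_wordV. Qed.

Lemma B3_ind (P : B3 -> Prop) :
  P 1 -> (forall x g, P g -> P (B3_of_word [:: x] * g)) -> forall g, P g.
Proof.
move=> P1 PM g; have [w ->] := B3_wordP g; elim: w => [//|x w IHw].
by rewrite -cat1s B3_of_wordM; apply: PM.
Qed.

Lemma DeltaE : Delta = sigma2 * sigma1 * sigma2.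
Proof. exact: braid_relation. Qed.

Lemma sigma1_Delta : sigma1 * Delta = Delta * sigma2.
Proof. by rewrite {1}DeltaE /Delta !mulgA. Qed.

Lemma sigma2_Delta : sigma2 * Delta = Delta * sigma1.
Proof. by rewrite {2}DeltaE /Delta !mulgA. Qed.

Lemma Delta2_commute g : commute g (Delta ^+ 2).
Proof.
have c1 : commute sigma1 (Delta ^+ 2).
  by rewrite /commute expg2 (mulgA _ Delta) sigma1_Delta -mulgA sigma2_Delta
    mulgA.
have c2 : commute sigma2 (Delta ^+ 2).
  by rewrite /commute expg2 (mulgA _ Delta) sigma2_Delta -mulgA sigma1_Delta
    mulgA.
elim/B3_ind: g => [|[i e] g IHg]; first by apply/commute_sym; exact: commute1.
apply/commute_sym; apply: commuteM; apply/commute_sym => //.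
rewrite B3_of_letter; case: i e => [] [] //=;
  by apply/commute_sym; apply: commuteV; exact: commute_sym.
Qed.

Section LetterAction.
Variables (T : Type) (step : letter -> T -> T).

Definition braid_action : Prop :=
  (forall x s, step x (step (linv x) s) = s) /\
  (forall s, let s1 := step (false, false) in let s2 := step (true, false) in
     s1 (s2 (s1 s)) = s2 (s1 (s2 s))).

Definition act (g : B3) (s : T) : T := foldr step s (repr g).

Hypothesis stepP : braid_action.

Lemma act_of_word w s : act (B3_of_word w) s = foldr step s w.
Proof.
have [cancel braid] := stepP.
have := repr_B3_of_word w; rewrite /act; move: (repr _) => u uw.
elim: uw s => {u w} //=.
- by move=> u v w _ IH1 _ IH2 s; rewrite IH1 IH2.
- by move=> u u' v v' _ IHu _ IHv s; rewrite !foldr_cat IHv IHu.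
Qed.

Lemma act1 s : act 1 s = s.
Proof. exact: act_of_word. Qed.

Lemma actM g h s : act (g * h) s = act g (act h s).
Proof.
have [[u ->] [v ->]] := (B3_wordP g, B3_wordP h).
by rewrite -B3_of_wordM !act_of_word foldr_cat.
Qed.

Lemma actK g s : act g^-1 (act g s) = s.
Proof. by rewrite -actM mulVg act1. Qed.

Lemma act_sigma1 s : act sigma1 s = step (false, false) s.
Proof. exact: act_of_word. Qed.

Lemma act_sigma2 s : act sigma2 s = step (true, false) s.
Proof. exact: act_of_word. Qed.

Lemma act_letter x s : act (B3_of_word [:: x]) s = step x s.
Proof. exact: act_of_word. Qed.

End LetterAction.

(** * Degree *)

Definition degree_step (x : letter) (d : Z) : Z :=
  (if x.2 then d - 1 else d + 1)%Z.

Lemma degree_stepP : braid_action degree_step.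
Proof. by split=> [[i []]|] /=; rewrite /degree_step /=; lia. Qed.

(** The abelianization of the braid group, which separates the types. *)
Definition degree (g : B3) : Z := act degree_step g 0%Z.

Lemma act_degree g d : act degree_step g d = (degree g + d)%Z.
Proof.
rewrite /degree; elim/B3_ind: g d => [|x g IHg] d.
  by rewrite !(act1 degree_stepP).
rewrite !(actM degree_stepP) IHg !(act_letter degree_stepP) /degree_step.
by case: x.2; lia.
Qed.

Lemma degree1 : degree 1 = 0%Z.
Proof. exact: act1 degree_stepP _. Qed.

Lemma degreeM g h : degree (g * h) = (degree g + degree h)%Z.
Proof. by rewrite {1}/degree (actM degree_stepP) act_degree. Qed.

Lemma degreeV g : degree g^-1 = (- degree g)%Z.
Proof. by have := degreeM g g^-1; rewrite mulgV degree1; lia. Qed.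

Lemma degreeX g n : degree (g ^+ n) = (Z.of_nat n * degree g)%Z.
Proof.
by elim: n => [|n IHn]; rewrite ?degree1 // expgS degreeM IHn; lia.
Qed.

Lemma degree_sigma1 : degree sigma1 = 1%Z.
Proof. exact: act_sigma1 degree_stepP _. Qed.

Lemma degree_sigma2 : degree sigma2 = 1%Z.
Proof. exact: act_sigma2 degree_stepP _. Qed.

Lemma degree_Delta2 : degree (Delta ^+ 2) = 6%Z.
Proof. by rewrite degreeX !degreeM degree_sigma1 degree_sigma2. Qed.

Lemma degree_type n g : has_type n g -> degree g = Z.of_nat n.
Proof.
case=> h [k ->] ->; rewrite degreeX !degreeM degreeV degree_sigma1; lia.
Qed.

(** * The action on the plane *)

Definition vec : Type := (Z * Z)%type.
Definition e1 : vec := (1, 0)%Z.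

Definition det (v w : vec) : Z := (v.1 * w.2 - v.2 * w.1)%Z.
Definition addZ (v : vec) (c : Z) (w : vec) : vec :=
  (v.1 + c * w.1, v.2 + c * w.2)%Z.
Definition oppv (v : vec) : vec := (- v.1, - v.2)%Z.

Definition vstep (x : letter) (v : vec) : vec :=
  (match x with
   | (false, false) => (v.1 - v.2, v.2)
   | (false, true) => (v.1 + v.2, v.2)
   | (true, false) => (v.1, v.2 + v.1)
   | (true, true) => (v.1, v.2 - v.1)
   end)%Z.

Lemma vstepP : braid_action vstep.
Proof.
split=> [[[] []] [x y]|[x y]] /=; rewrite /vstep /=; congr (_, _); lia.
Qed.

Definition vact : B3 -> vec -> vec := act vstep.

Lemma vact1 v : vact 1 v = v. Proof. exact: act1 vstepP v. Qed.
Lemma vactM g h v : vact (g * h) v = vact g (vact h v).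
Proof. exact: actM vstepP g h v. Qed.
Lemma vactK g v : vact g^-1 (vact g v) = v. Proof. exact: actK vstepP g v. Qed.
Lemma vactVK g v : vact g (vact g^-1 v) = v.
Proof. by rewrite -vactM mulgV vact1. Qed.

Lemma vact_sigma1 x y : vact sigma1 (x, y) = (x - y, y)%Z.
Proof.
by rewrite /vact (act_sigma1 vstepP) /vstep /=; congr (_, _); lia.
Qed.

Lemma vact_sigma2 x y : vact sigma2 (x, y) = (x, y + x)%Z.
Proof.
by rewrite /vact (act_sigma2 vstepP) /vstep /=; congr (_, _); lia.
Qed.

Lemma vact_addZ g v c w : vact g (addZ v c w) = addZ (vact g v) c (vact g w).
Proof.
elim/B3_ind: g => [|x g IHg]; first by rewrite !vact1.
rewrite !vactM IHg /vact !(act_letter vstepP).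
case: (act _ g v) (act _ g w) => [v1 v2] [w1 w2].
by case: x => [[] []]; rewrite /vstep /addZ /=; congr (_, _); lia.
Qed.

Lemma det_vact g v w : det (vact g v) (vact g w) = det v w.
Proof.
elim/B3_ind: g => [|x g IHg]; first by rewrite !vact1.
rewrite !vactM -IHg /vact !(act_letter vstepP).
case: (act _ g v) (act _ g w) => [v1 v2] [w1 w2].
by case: x => [[] []]; rewrite /vstep /det /=; lia.
Qed.

Lemma vact_opp g v : vact g (oppv v) = oppv (vact g v).
Proof.
have -> : oppv v = addZ v (-2) v by rewrite /oppv /addZ; congr (_, _); lia.
by rewrite vact_addZ /oppv /addZ; congr (_, _); lia.
Qed.

Lemma vact_Delta v : vact Delta v = (- v.2, v.1)%Z.
Proof.
case: v => x y; rewrite /Delta !vactM !(vact_sigma1, vact_sigma2) /=.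
by congr (_, _); lia.
Qed.

Lemma vact_Delta2 v : vact (Delta ^+ 2) v = oppv v.
Proof. by rewrite expg2 vactM !vact_Delta. Qed.

(** The [n]-th power of the transvection along [v]. *)
Definition transvection (v : vec) (n : Z) (w : vec) : vec :=
  addZ w (- (n * det v w)) v.

(** A conjugate of the transvection along [e1] is the transvection along the
  image of [e1], because the action preserves determinants. *)
Lemma vact_twist g n w :
  vact ((g * sigma1 * g^-1) ^+ n) w = transvection (vact g e1) (Z.of_nat n) w.
Proof.
have tr1 u : vact (g * sigma1 * g^-1) u = transvection (vact g e1) 1 u.
  rewrite !vactM /transvection -{2 3}(vactVK g u) det_vact.
  case: (vact g^-1 u) => x y; rewrite vact_sigma1 -vact_addZ.
  by congr (vact g _); rewrite /addZ /det /=; congr (_, _); lia.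
elim: n => [|n IHn].
  by rewrite vact1 /transvection /addZ; case: w => x y /=; congr (_, _); lia.
rewrite expgS vactM IHn tr1 /transvection /addZ /det.
by move: (vact g e1) => [a b]; case: w {IHn} => x y /=; congr (_, _); lia.
Qed.

Lemma transvectionK v n : cancel (transvection v (- n)) (transvection v n).
Proof.
by case: v => a b [x y]; rewrite /transvection /addZ /det /=; congr (_, _); ring.
Qed.

(** * Rotation of directions *)

(** 0 for the directions of angle in [0, pi) and 1 for those in [pi, 2 pi). *)
Definition half (v : vec) : Z :=
  (if (0 <? v.2) || ((v.2 =? 0) && (0 <? v.1)) then 0 else 1)%Z.

Lemma halfP x y :
  (half (x, y) = 0 /\ (0 < y \/ y = 0 /\ 0 < x) \/
   half (x, y) = 1 /\ (y < 0 \/ y = 0 /\ x <= 0))%Z.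
Proof.
rewrite /half /=; case: (Z.ltb_spec 0 y) => /= ?; first by left; lia.
case: (Z.eqb_spec y 0) => /= ?; last by right; lia.
by case: (Z.ltb_spec 0 x) => /= ?; [left|right]; lia.
Qed.

Lemma half_shear x y : half (x - y, y)%Z = half (x, y).
Proof. by have := halfP x y; have := halfP (x - y) y; lia. Qed.

(** A direction, given by a nonzero vector, with a number of full turns: a point
  of the universal cover of the circle of directions. *)
Definition dir : Type := (vec * Z)%type.

(** The turn count changes when the positive x-axis is crossed; [sigma1] fixes
  that axis, so only the letters of [sigma2] can cross it. *)
Definition dstep (x : letter) (s : dir) : dir :=
  let v := s.1 in let w := vstep x v in
  (w, (if x.2 then s.2 - Z.max 0 (half w - half v)
       else s.2 + Z.max 0 (half v - half w)))%Z.

Lemma dstepP : braid_action dstep.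
Proof.
have [cancel braid] := vstepP.
split=> [x|] [[x0 y0] m]; congr (_, _).
- exact: cancel x (x0, y0).
- rewrite /dstep /fst /snd cancel; case: x => [[] []] /=; lia.
- exact: braid (x0, y0).
(* Both sides rotate by a quarter-turn in all, from (x0, y0) to (-y0, x0), and
   the right-hand side passes through (x0, x0 + y0). *)
- rewrite /dstep /vstep /= !half_shear.
  have -> : (y0 + (x0 - y0) = x0)%Z by lia.
  have -> : (y0 + x0 + (x0 - (y0 + x0)) = x0)%Z by lia.
  have -> : half (x0 - y0, x0)%Z = half (- y0, x0)%Z.
    by rewrite -half_shear; congr (half (_, _)); lia.
  have -> : (x0 - (y0 + x0) = - y0)%Z by lia.
  have := halfP x0 y0; have := halfP x0 (y0 + x0); have := halfP (- y0) x0.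
  by move=> [] [-> ?] [] [-> ?] [] [-> ?]; lia.
Qed.

Definition dact : B3 -> dir -> dir := act dstep.

Lemma dact1 s : dact 1 s = s. Proof. exact: act1 dstepP s. Qed.
Lemma dactM g h s : dact (g * h) s = dact g (dact h s).
Proof. exact: actM dstepP g h s. Qed.
Lemma dactVK g s : dact g (dact g^-1 s) = s.
Proof. by rewrite -dactM mulgV dact1. Qed.

Lemma dact_fst g s : (dact g s).1 = vact g s.1.
Proof.
elim/B3_ind: g => [|x g IHg]; first by rewrite dact1 vact1.
rewrite dactM vactM -IHg /dact /vact.
by rewrite (act_letter dstepP) (act_letter vstepP).
Qed.

(** The number of half-turns, that is, the integral part of angle / pi. *)
Definition level (s : dir) : Z := (2 * s.2 + half s.1)%Z.

(** The order of the universal cover: within one half-plane, comparing angles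
  is taking the sign of the determinant. *)
Definition dle (s t : dir) : Prop :=
  (level s < level t \/ level s = level t /\ 0 <= det s.1 t.1)%Z.

Definition nonzero (s : dir) : Prop := (s.1.1 <> 0 \/ s.1.2 <> 0)%Z.

Lemma nonzero_dact g s : nonzero s -> nonzero (dact g s).
Proof.
elim/B3_ind: g => [|x g IHg s0]; first by rewrite dact1.
rewrite dactM /dact (act_letter dstepP); move: (IHg s0); rewrite /nonzero /dact.
by case: (act _ g s) => [[a b] k]; case: x => [[] []] /=; lia.
Qed.

Lemma dle_trans t s u :
  nonzero s -> nonzero t -> nonzero u -> dle s t -> dle t u -> dle s u.
Proof.
case: s t u => [[a b] k] [[c d] l] [[e f] m]; rewrite /nonzero /dle /level /=.
move=> s0 t0 u0 st tu.
case: st => [|[st st']]; first by case: tu; lia.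
case: tu => [|[tu tu']]; first by lia.
right; split; first by lia.
move: st' tu'; rewrite /det /= => st' tu'.
(* The vectors lie in one half-plane, where second coordinates are nonnegative
   up to a common sign; this identity then gives the sign of det(s, u). *)
have H : (d * (a * f - b * e) = b * (c * f - d * e) + f * (a * d - b * c))%Z.
  by ring.
have := halfP a b; have := halfP c d; have := halfP e f.
move=> h1 h2 h3.
have {}h : (half (a, b) = half (c, d) /\ half (c, d) = half (e, f))%Z by lia.
nia.
Qed.

(** Each letter and its inverse act by increasing maps, since they preserve
  determinants and cross the positive x-axis consistently. *)
Lemma dle_dstep x s t :
  nonzero s -> nonzero t -> dle s t -> dle (dstep x s) (dstep x t).
Proof.
case: s t => [[a b] k] [[c d] l]; rewrite /nonzero /dle /level /= => s0 t0.
have -> : det (vstep x (a, b)) (vstep x (c, d)) = det (a, b) (c, d).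
  by case: x => [[] []]; rewrite /det /=; ring.
case: x => [[] []] /=; rewrite ?half_shear.
- have := halfP a b; have := halfP c d.
  have := halfP a (b - a); have := halfP c (d - c).
  rewrite /det /=; move=> [] [-> ?] [] [-> ?] [] [-> ?] [] [-> ?]; nia.
- have := halfP a b; have := halfP c d.
  have := halfP a (b + a); have := halfP c (d + c).
  rewrite /det /=; move=> [] [-> ?] [] [-> ?] [] [-> ?] [] [-> ?]; nia.
- have := half_shear (a + b) b; have := half_shear (c + d) d.
  have -> : (a + b - b = a)%Z by lia. have -> : (c + d - d = c)%Z by lia.
  by move=> <- <-; lia.
- by lia.
Qed.

Lemma dle_dact g s t :
  nonzero s -> nonzero t -> dle s t -> dle (dact g s) (dact g t).
Proof.
move=> s0 t0 st; elim/B3_ind: g => [|x g IHg]; first by rewrite !dact1.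
rewrite !dactM /dact !(act_letter dstepP).
by apply: dle_dstep; [exact: nonzero_dact | exact: nonzero_dact | exact: IHg].
Qed.

(** The submonoid of braids moving no direction backwards is invariant under
  conjugation, as the action is increasing; it contains the positive
  half-twists. *)
Definition turns_left (g : B3) : Prop :=
  forall s, nonzero s -> dle s (dact g s).

Lemma turns_left1 : turns_left 1.
Proof. by move=> s _; rewrite dact1 /dle /det; right; split; lia. Qed.

Lemma turns_leftM g h : turns_left g -> turns_left h -> turns_left (g * h).
Proof.
move=> gP hP s s0; have hs0 := nonzero_dact h s0.
rewrite dactM; apply: (dle_trans (t := dact h s)) => //.
- exact: nonzero_dact.
- exact: hP.
- exact: gP.
Qed.

Lemma turns_leftX g n : turns_left g -> turns_left (g ^+ n).
Proof.
move=> gP; elim: n => [|n IHn]; first exact: turns_left1.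
by rewrite expgS; exact: turns_leftM.
Qed.

Lemma turns_left_conj h g : turns_left g -> turns_left (h * g * h^-1).
Proof.
move=> gP s s0; have s0' := nonzero_dact h^-1 s0.
rewrite !dactM -{1}(dactVK h s).
by apply: dle_dact => //; [exact: nonzero_dact | exact: gP].
Qed.

Lemma turns_left_sigma1 : turns_left sigma1.
Proof.
move=> [[x y] m] _; rewrite /dact (act_sigma1 dstepP) /dle /level /det /=.
by right; rewrite half_shear; split; nia.
Qed.

Lemma dact_Delta v m :
  dact Delta (v, m) = ((- v.2, v.1), m + Z.max 0 (half v - half (- v.2, v.1)))%Z.
Proof.
case: v => x y; rewrite /Delta !dactM /dact.
rewrite !(act_sigma1 dstepP) (act_sigma2 dstepP) /dstep /= !half_shear.
have -> : (y + (x - y) = x)%Z by lia.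
have -> : half (x - y, x)%Z = half (- y, x)%Z.
  by rewrite -half_shear; congr (half (_, _)); lia.
by congr ((_, _), _); lia.
Qed.

Lemma level_Delta2 s : nonzero s -> level (dact (Delta ^+ 2) s) = (level s + 1)%Z.
Proof.
case: s => [[x y] m]; rewrite /nonzero /= => s0.
rewrite expg2 dactM !dact_Delta /level /=.
have := halfP x y; have := halfP (- y) x; have := halfP (- x) (- y).
by move=> [] [-> ?] [] [-> ?] [] [-> ?]; lia.
Qed.

(** In the universal cover [s <= g s <= g h s = Delta^2 s], and [Delta^2 s] is [s]
  half a turn further. *)
Lemma det_prefix_ge0 g h v :
  v <> (0, 0)%Z -> turns_left g -> turns_left h -> g * h = Delta ^+ 2 ->
  (0 <= det v (vact g v))%Z.
Proof.
move=> v0 gP hP gh; pose s : dir := (v, 0%Z).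
have s0 : nonzero s.
  rewrite /nonzero /=; case: v v0 {s} => a b v0 /=.
  by case: (Z.eq_dec a 0) => [a0|]; [right=> b0; apply: v0; rewrite a0 b0|left].
have s_gs := gP _ s0.
have gs_s : dle (dact g s) (dact (Delta ^+ 2) s).
  rewrite -gh dactM; apply: dle_dact => //; last exact: hP.
  exact: nonzero_dact.
move: s_gs gs_s; rewrite /dle level_Delta2 // !dact_fst vact_Delta2.
rewrite /det /=; lia.
Qed.

(** The form [det(w, g w)] of [det_prefix_ge0] for the product of the two powers is
  [n B^2 + m A^2 - m n D A B], with [A], [B] the pairings of [w] with the two
  vectors and [D] their determinant.  Being nonnegative, it has a nonpositive
  discriminant. *)
Lemma twist_pair_bound g h m n q :
  turns_left q ->
  (g * sigma1 * g^-1) ^+ m * (h * sigma1 * h^-1) ^+ n * q = Delta ^+ 2 ->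
  (Z.of_nat m * Z.of_nat n * (det (vact g e1) (vact h e1)) ^ 2 <= 4)%Z.
Proof.
move=> qP prodE; set a := vact g e1; set b := vact h e1.
have twP k l : turns_left ((k * sigma1 * k^-1) ^+ l).
  by apply/turns_leftX/turns_left_conj/turns_left_sigma1.
have form w : w <> (0, 0)%Z ->
    (0 <= Z.of_nat n * det b w ^ 2 + Z.of_nat m * det a w ^ 2
          - Z.of_nat m * Z.of_nat n * det a b * det a w * det b w)%Z.
  move=> /det_prefix_ge0 /(_ (turns_leftM (twP g m) (twP h n)) qP prodE).
  rewrite vactM !vact_twist -/a -/b /transvection /addZ /det /=; lia.
case: (Z.eq_dec (det a b) 0) => [->|ab0]; first by lia.
case: (Z.eq_dec (Z.of_nat m) 0) => [->|m0]; first by lia.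
set c := (Z.of_nat m * det a b)%Z.
(* The minimum of the form on a line with A fixed, cleared of denominators. *)
pose w : vec := (2 * b.1 - c * a.1, 2 * b.2 - c * a.2)%Z.
have aw : det a w = (2 * det a b)%Z by rewrite /w /det /=; ring.
have bw : det b w = (c * det a b)%Z by rewrite /w /det /=; ring.
have /form : w <> (0, 0)%Z.
  by move=> w0; move: aw; rewrite w0 {1}/det /=; lia.
rewrite aw bw /c; move: (det a b) ab0 => d d0.
have -> : (Z.of_nat n * (Z.of_nat m * d * d) ^ 2 + Z.of_nat m * (2 * d) ^ 2
   - Z.of_nat m * Z.of_nat n * d * (2 * d) * (Z.of_nat m * d * d)
   = Z.of_nat m * d ^ 2 * (4 - Z.of_nat m * Z.of_nat n * d ^ 2))%Z by ring.
have : (0 < Z.of_nat m * d ^ 2)%Z by nia.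
nia.
Qed.

(** * A half-twist is determined by its vector *)

(** The half-twist of the vector [(x, y)], by the Euclidean algorithm: a
  generator or its inverse shortens the vector, and the corresponding
  conjugation is undone on the half-twist.  The fuel [k] must exceed
  [|x| + |y|]. *)
Fixpoint twist_rec (k : nat) (x y : Z) : B3 :=
  if k isn't k'.+1 then 1 else
  if (x =? 0)%Z then (if (y =? 0)%Z then 1 else sigma2) else
  if (y =? 0)%Z then sigma1 else
  if ((0 <? x) == (0 <? y))%Z then
    if (Z.abs y <=? Z.abs x)%Z then twist_rec k' (x - y) y ^ sigma1
    else twist_rec k' x (y - x) ^ sigma2^-1
  else
    if (Z.abs y <=? Z.abs x)%Z then twist_rec k' (x + y) y ^ sigma1^-1
    else twist_rec k' x (y + x) ^ sigma2.

Lemma twist_rec_fuel k l x y :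
  (Z.abs x + Z.abs y < Z.of_nat k)%Z -> (Z.abs x + Z.abs y < Z.of_nat l)%Z ->
  twist_rec k x y = twist_rec l x y.
Proof.
elim: k l x y => [|k IHk] [|l] x y /= kP lP; try lia.
case: (Z.eqb_spec x 0) => // x0; case: (Z.eqb_spec y 0) => // y0.
case: (Z.ltb_spec 0 x); case: (Z.ltb_spec 0 y);
  case: (Z.leb_spec (Z.abs y) (Z.abs x)) => /= *;
  by rewrite (IHk l) //; lia.
Qed.

Definition twist (x y : Z) : B3 :=
  twist_rec (Z.to_nat (Z.abs x + Z.abs y)).+1 x y.

Lemma twistE x y :
  twist x y =
  if (x =? 0)%Z then (if (y =? 0)%Z then 1 else sigma2) else
  if (y =? 0)%Z then sigma1 else
  if ((0 <? x) == (0 <? y))%Z then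
    if (Z.abs y <=? Z.abs x)%Z then twist (x - y) y ^ sigma1
    else twist x (y - x) ^ sigma2^-1
  else
    if (Z.abs y <=? Z.abs x)%Z then twist (x + y) y ^ sigma1^-1
    else twist x (y + x) ^ sigma2.
Proof.
rewrite {1}/twist [LHS]/=.
case: (Z.eqb_spec x 0) => // x0; case: (Z.eqb_spec y 0) => // y0.
case: (Z.ltb_spec 0 x); case: (Z.ltb_spec 0 y);
  case: (Z.leb_spec (Z.abs y) (Z.abs x)) => /= *;
  by congr (_ ^ _); apply: twist_rec_fuel; lia.
Qed.

Lemma twist_x0 x : x <> 0%Z -> twist x 0 = sigma1.
Proof. by move=> x0; rewrite twistE; case: Z.eqb_spec. Qed.

Lemma twist_0y y : y <> 0%Z -> twist 0 y = sigma2.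
Proof. by move=> y0; rewrite twistE /=; case: Z.eqb_spec. Qed.

Local Ltac twist_branch :=
  move=> *; match goal with |- twist ?x ?y = _ =>
    rewrite [LHS]twistE;
    case: Z.eqb_spec => [|_]; [nia|];
    case: Z.eqb_spec => [|_]; [nia|];
    case: (Z.ltb_spec 0 x); case: (Z.ltb_spec 0 y); case: Z.leb_spec => //=; nia
  end.

Lemma twist_same_ge x y : (0 < x * y)%Z -> (Z.abs y <= Z.abs x)%Z ->
  twist x y = twist (x - y) y ^ sigma1.
Proof. by twist_branch. Qed.

Lemma twist_same_lt x y : (0 < x * y)%Z -> (Z.abs x < Z.abs y)%Z ->
  twist x y = twist x (y - x) ^ sigma2^-1.
Proof. by twist_branch. Qed.

Lemma twist_opp_ge x y : (x * y < 0)%Z -> (Z.abs y <= Z.abs x)%Z ->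
  twist x y = twist (x + y) y ^ sigma1^-1.
Proof. by twist_branch. Qed.

Lemma twist_opp_lt x y : (x * y < 0)%Z -> (Z.abs x < Z.abs y)%Z ->
  twist x y = twist x (y + x) ^ sigma2.
Proof. by twist_branch. Qed.

Lemma sigma1_Delta_inv : sigma1 * Delta^-1 = Delta^-1 * sigma2.
Proof. by apply: (mulgI Delta); rewrite mulVKg mulgA -sigma2_Delta mulgK. Qed.

Lemma sigma2_Delta_inv : sigma2 * Delta^-1 = Delta^-1 * sigma1.
Proof. by apply: (mulgI Delta); rewrite mulVKg mulgA -sigma1_Delta mulgK. Qed.

Lemma conj_sigma1_Delta : sigma1 ^ Delta^-1 = sigma2.
Proof. by rewrite /conjg invgK sigma1_Delta_inv mulVKg. Qed.

Lemma conj_sigma2_Delta : sigma2 ^ Delta^-1 = sigma1.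
Proof. by rewrite /conjg invgK sigma2_Delta_inv mulVKg. Qed.

Lemma sigma2_conj_sigma1 : sigma2 ^ sigma1 = sigma1 ^ sigma2^-1.
Proof.
apply: (mulgI sigma1); apply: (mulIg sigma2); rewrite /conjg invgK mulVKg.
by rewrite !mulgA mulgVK -braid_relation.
Qed.

Lemma sigma2_conj_sigma1V : sigma2 ^ sigma1^-1 = sigma1 ^ sigma2.
Proof.
apply: (mulgI sigma2); apply: (mulIg sigma1); rewrite /conjg invgK mulVKg.
by rewrite !mulgA mulgVK -braid_relation.
Qed.

(** [Delta] acts as the quarter-turn and exchanges the generators, which exchanges
  the branches of the Euclidean algorithm.  When [|x| = |y|] the algorithm breaks a
  tie, and the two sides agree by the braid relation. *)
Lemma twist_Delta x y : twist (- y) x = twist x y ^ Delta^-1.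
Proof.
have [k] : exists k, (Z.abs x + Z.abs y < Z.of_nat k)%Z.
  by exists (Z.to_nat (Z.abs x + Z.abs y)).+1; lia.
elim: k x y => [|k IHk] x y xyk; first by lia.
case: (Z.eq_dec x 0) => [->|x0].
  case: (Z.eq_dec y 0) => [->|y0]; first by rewrite conj1g.
  rewrite twist_x0; last by lia.
  by rewrite twist_0y // conj_sigma2_Delta.
case: (Z.eq_dec y 0) => [->|y0].
  by rewrite twist_0y ?twist_x0 ?conj_sigma1_Delta.
have [xy|xy] : (0 < x * y \/ x * y < 0)%Z by nia.
- have s : (0 < x /\ 0 < y \/ x < 0 /\ y < 0)%Z by nia.
  case: (Z.compare_spec (Z.abs y) (Z.abs x)) => yx.
  + have {xy yx s} -> : y = x by lia.
    rewrite twist_opp_ge ?(@twist_same_ge x x); try nia.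
    have -> : (- x + x = 0)%Z by lia. have -> : (x - x = 0)%Z by lia.
    by rewrite !twist_0y // conjJg conj_sigma1_Delta conj_sigma2_Delta
      sigma2_conj_sigma1V.
  + rewrite twist_opp_lt ?(@twist_same_ge x y); try nia.
    have -> : (x + - y = x - y)%Z by lia.
    rewrite IHk; last by lia.
    by rewrite (conjJg _ sigma1) conj_sigma1_Delta.
  + rewrite twist_opp_ge ?(@twist_same_lt x y); try nia.
    have -> : (- y + x = - (y - x))%Z by lia.
    rewrite IHk; last by lia.
    by rewrite (conjJg _ sigma2^-1) conjVg conj_sigma2_Delta.
- have s : (0 < x /\ y < 0 \/ x < 0 /\ 0 < y)%Z by nia.
  case: (Z.compare_spec (Z.abs y) (Z.abs x)) => yx.
  + have {xy yx s} -> : y = (- x)%Z by lia.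
    have -> : (- - x = x)%Z by lia.
    rewrite twist_same_ge ?(@twist_opp_ge x (- x)); try nia.
    have -> : (x + - x = 0)%Z by lia. have -> : (x - x = 0)%Z by lia.
    rewrite !twist_0y; try lia.
    by rewrite conjJg conjVg conj_sigma1_Delta conj_sigma2_Delta sigma2_conj_sigma1.
  + rewrite twist_same_lt ?(@twist_opp_ge x y); try nia.
    have -> : (x - - y = x + y)%Z by lia.
    rewrite IHk; last by lia.
    by rewrite (conjJg _ sigma1^-1) conjVg conj_sigma1_Delta.
  + rewrite twist_same_ge ?(@twist_opp_lt x y); try nia.
    have -> : (- y - x = - (y + x))%Z by lia.
    rewrite IHk; last by lia.
    by rewrite (conjJg _ sigma2) conj_sigma2_Delta.
Qed.

Lemma twist_opp x y : twist (- x) (- y) = twist x y.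
Proof.
rewrite !twist_Delta -conjgM -invgM -expg2 /conjg invgK mulgA.
by rewrite -(Delta2_commute (twist x y)) mulgK.
Qed.

(** The shear either undoes a step of the algorithm or is undone by one, except for
  [0 < x < y] up to sign, where the two steps taken from either side meet after the
  quarter-turn of [Delta]. *)
Lemma twist_sigma1 x y : twist (x - y) y = twist x y ^ sigma1^-1.
Proof.
case: (Z.eq_dec x 0) => [->|x0].
  case: (Z.eq_dec y 0) => [->|y0]; first by rewrite conj1g.
  rewrite twist_opp_ge; try nia.
  by have -> : (0 - y + y = 0)%Z by lia.
case: (Z.eq_dec y 0) => [->|y0].
  rewrite !twist_x0; try lia.
  by rewrite /conjg invgK mulgV mulg1.
have [xy|xy] : (0 < x * y \/ x * y < 0)%Z by nia.
  case: (Z.le_gt_cases (Z.abs y) (Z.abs x)) => yx.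
    by rewrite (@twist_same_ge x y) // conjgK.
  rewrite (@twist_same_lt x y) // twist_opp_lt; try nia.
  have -> : (x - y = - (y - x))%Z by lia.
  have -> : (y + - (y - x) = x)%Z by lia.
  rewrite twist_Delta -!conjgM; congr (_ ^ _).
  by rewrite -invgM -[in LHS](invgK sigma2) -invgM DeltaE -mulgA mulKg.
rewrite twist_opp_ge; try nia.
by have -> : (x - y + y = x)%Z by lia.
Qed.

Lemma twist_sigma2 x y : twist x (y + x) = twist x y ^ sigma2^-1.
Proof.
have E u v : twist (- v) u = twist u v ^ Delta^-1 := twist_Delta u v.
have -> : twist x (y + x) = twist (y + x) (- x) ^ Delta^-1.
  by rewrite -E; congr twist; lia.
have -> : twist x y = twist y (- x) ^ Delta^-1.
  by rewrite -E; congr twist; lia.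
have -> : twist (y + x) (- x) = twist y (- x) ^ sigma1^-1.
  by rewrite -twist_sigma1; congr twist; lia.
by rewrite (conjJg _ sigma1^-1) conjVg conj_sigma1_Delta.
Qed.

Lemma twist_vact g v :
  twist (vact g v).1 (vact g v).2 = g * twist v.1 v.2 * g^-1.
Proof.
elim/B3_ind: g => [|x g IHg]; first by rewrite vact1 invg1 mulg1 mul1g.
rewrite vactM invgM.
rewrite [RHS](_ : _ = (g * twist v.1 v.2 * g^-1) ^ (B3_of_word [:: x])^-1);
  last by rewrite /conjg invgK !mulgA.
rewrite -{}IHg /vact (act_letter vstepP); move: (act vstep g v) => [a b].
case: x => i e; rewrite B3_of_letter; case: i e => [] [] /=.
- rewrite invgK -{2}(_ : b - a + a = b)%Z; last by lia.
  by rewrite twist_sigma2 conjgKV.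
- exact: twist_sigma2.
- rewrite invgK -{2}(_ : a + b - b = a)%Z; last by lia.
  by rewrite twist_sigma1 conjgKV.
- exact: twist_sigma1.
Qed.

Lemma half_twist_vactE g : g * sigma1 * g^-1 = twist (vact g e1).1 (vact g e1).2.
Proof. by rewrite twist_vact. Qed.

(** * The finite check *)

Definition e2 : vec := (0, 1)%Z.
(** The [n]-th power of the half-twist of [v] is recorded as [(v, n)]. *)
Definition entry : Type := (vec * nat)%type.

Fixpoint hurwitz_moves (c : seq entry) : seq (seq entry) :=
  if c is a :: c' then
    if c' is b :: t then
      [:: (transvection a.1 (Z.of_nat a.2) b.1, b.2) :: a :: t,
          b :: (transvection b.1 (- Z.of_nat b.2) a.1, a.2) :: t
        & map (cons a) (hurwitz_moves c')]
    else [::]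
  else [::].

Definition conj_moves (c : seq entry) : seq (seq entry) :=
  [seq [seq (vstep x e.1, e.2) | e <- c]
     | x <- [:: (false, false); (false, true); (true, false); (true, true)]].

(** Opposite vectors belong to the same half-twist. *)
Definition normv (v : vec) : vec :=
  if ((0 <? v.1) || ((v.1 =? 0) && (0 <? v.2)))%Z then v else oppv v.

Definition normc (c : seq entry) : seq entry := [seq (normv e.1, e.2) | e <- c].

(** A lexicographic comparison from the last entry on, squares being smaller than
  half-twists and then vectors with a small value of [x^2 + 2xy + 3y^2] being
  smaller.  Only the success of the greedy descent matters, and many
  other positive definite forms would do; 1000 exceeds the contribution of each
  entry of [box]. *)
Definition rank (c : seq entry) : Z :=
  foldr (fun e r => let: ((x, y), n) := e in
           x * x + 2 * x * y + 3 * y * y + 500 * (2 - Z.of_nat n) + 1000 * r)%Z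
    0%Z c.

Definition best_move (c : seq entry) : seq entry :=
  foldr (fun d b => if (rank d <? rank b)%Z then d else b) c
    (map normc (hurwitz_moves c ++ conj_moves c)).

(** Ten rounds suffice for the lists below to reach a local minimum of [rank]. *)
Definition normal_form (c : seq entry) : seq entry := ssrnat.iter 10 best_move c.

(** The vectors allowed by the bounds against the first two factors, up to sign,
  with the exponents that these bounds allow. *)
Definition box : seq entry :=
  [seq (v, 1%nat) | v <- [:: (1, 0); (0, 1); (1, 1); (1, -1);
                          (2, 1); (2, -1); (1, 2); (1, -2)]%Z] ++
  [seq (v, 2) | v <- [:: (1, 0); (0, 1); (1, 1); (1, -1)]%Z].

Definition weight (c : seq entry) : nat := sumn (map snd c).

(** The lists over [box] of weight [w] and length at most [k]. *)
Fixpoint codes (k w : nat) : seq (seq entry) :=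
  if w is 0 then [:: [::]] else
  if k is k'.+1 then
    [seq e :: c | e <- [seq e <- box | e.2 <= w], c <- codes k' (w - e.2)]
  else [::].

(** The product of the transvections is [-1]. *)
Definition closes (c : seq entry) : bool :=
  let p w := foldr (fun e w => transvection e.1 (Z.of_nat e.2) w) w c in
  (p e1 == oppv e1) && (p e2 == oppv e2).

Definition standard_codes : seq (seq entry) :=
  [:: [:: (e1, 1%nat); (e2, 1%nat); (e1, 1%nat); (e1, 1%nat); (e2, 1%nat);
          (e1, 1%nat)];
      [:: (e1, 2); (e2, 1%nat); (e1, 1%nat); (e1, 1%nat); (e2, 1%nat)];
      [:: (e1, 2); (e2, 1%nat); (e1, 2); (e2, 1%nat)];
      [:: (e1, 2); ((1, 1)%Z, 2); (e2, 2)] ].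

(** The possible first two factors: the last one is the case of determinant 2. *)
Definition fronts : seq (seq entry) :=
  [:: [:: (e1, 1%nat); (e2, 1%nat)]; [:: (e1, 1%nat); (e2, 2)];
      [:: (e1, 2); (e2, 1%nat)]; [:: (e1, 2); (e2, 2)];
      [:: (e1, 1%nat); ((1, 2)%Z, 1%nat)]].

Definition normal_codes : seq (seq entry) :=
  [:: [:: ((1, 1)%Z, 1%nat); ((1, -1)%Z, 1%nat);
          (e1, 1%nat); (e1, 1%nat); (e1, 1%nat); (e1, 1%nat)];
      [:: ((1, 1)%Z, 1%nat); ((1, -1)%Z, 1%nat); (e1, 1%nat); (e1, 1%nat); (e1, 2)];
      [:: ((1, 1)%Z, 1%nat); ((1, -1)%Z, 1%nat); (e1, 2); (e1, 2)];
      [:: (e2, 2); ((1, -1)%Z, 2); (e1, 2)] ].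

Definition candidates : seq (seq entry) :=
  flatten [seq [seq f ++ r | r <- codes 4 (6 - weight f)] | f <- fronts].

Lemma normal_form_standard : map normal_form standard_codes = normal_codes.
Proof. by vm_compute. Qed.

Lemma normal_form_candidates :
  all (fun c => normal_form c \in normal_codes) (filter closes candidates).
Proof. by vm_compute. Qed.

(** * Hurwitz equivalence *)

Section HurwitzTheory.
Variable G : groupType.
Implicit Types (g h x : G) (F : seq G).

Lemma hurwitz_step_sym F F' : hurwitz_step F F' -> hurwitz_step F' F.
Proof.
case=> [s t g h|s t g h|h {}F].
- have := hurwitz_right s t (g * h * g^-1) g.
  by rewrite !mulgA mulVg mul1g mulgVK.
- have := hurwitz_left s t h (h^-1 * g * h).
  by rewrite !mulgA mulgV mul1g mulgK.
- suff {2}<- : [seq h^-1 * g * h^-1^-1 | g <- [seq h * g * h^-1 | g <- F]] = F.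
    exact: hurwitz_conj.
  rewrite -map_comp map_id_in // => g _ /=.
  by rewrite invgK !mulgA mulVg mul1g mulgVK.
Qed.

Lemma hurwitz_refl F : hurwitz_equiv F F. Proof. exact: rt_refl. Qed.

Lemma hurwitz_trans F F' F'' :
  hurwitz_equiv F F' -> hurwitz_equiv F' F'' -> hurwitz_equiv F F''.
Proof. exact: rt_trans. Qed.

Lemma hurwitz_sym F F' : hurwitz_equiv F F' -> hurwitz_equiv F' F.
Proof.
elim=> {F F'} [F F' /hurwitz_step_sym|F|F F' F'' _ IH1 _ IH2].
- exact: rt_step.
- exact: rt_refl.
- exact: rt_trans IH2 IH1.
Qed.

Lemma hurwitz_factorization (z : G) F F' : (forall g, commute g z) ->
  hurwitz_equiv F F' -> factorization z F -> factorization z F'.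
Proof.
move=> zC; elim=> {F F'} [F F'|//|F F' F'' _ IH1 _ IH2 /IH1/IH2 //].
rewrite /factorization; case=> [s t g h|s t g h|h {}F] zE.
- by rewrite zE !big_cat !big_cons /= !mulgA mulgVK.
- by rewrite zE !big_cat !big_cons /= !mulgA mulgK.
- have -> : \prod_(x <- [seq h * g * h^-1 | g <- F]) x = (\prod_(x <- F) x) ^ h^-1.
    rewrite conjg_prod big_map; apply: eq_bigr => g _.
    by rewrite /conjg invgK mulgA.
  by rewrite -zE /conjg invgK -(zC h^-1) mulVKg.
Qed.

(** Moving [x] to the left past [g] conjugates [g] and keeps [x]. *)
Lemma hurwitz_to_front (p s t : seq G) x :
  hurwitz_equiv (p ++ s ++ x :: t) (p ++ x :: [seq x^-1 * g * x | g <- s] ++ t).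
Proof.
elim: s p => [|a s IHs] p; first exact: hurwitz_refl.
apply: (hurwitz_trans (F' := p ++ a :: x :: [seq x^-1 * g * x | g <- s] ++ t)).
  by have := IHs (rcons p a); rewrite !cat_rcons.
by apply: rt_step; exact: hurwitz_right.
Qed.

End HurwitzTheory.

Lemma has_type_conj n h g : has_type n (h * g * h^-1) <-> has_type n g.
Proof.
have conjP k u : has_type n u -> has_type n (k * u * k^-1).
  case=> _ [l ->] ->; exists (k * l * sigma1 * (k * l)^-1); first by exists (k * l).
  have -> : k * l * sigma1 * (k * l)^-1 = (l * sigma1 * l^-1) ^ k^-1.
    by rewrite /conjg invgK invgM !mulgA.
  by rewrite -conjXg /conjg invgK mulgA.
split; last exact: conjP.
by move=> /(conjP h^-1); rewrite invgK !mulgA mulVg mul1g mulgVK.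
Qed.

Lemma hurwitz_num_of_type n F F' :
  hurwitz_equiv F F' -> num_of_type n F = num_of_type n F'.
Proof.
have tE h g : `[< has_type n (h * g * h^-1) >] = `[< has_type n g >].
  exact/asbool_equiv_eq/has_type_conj.
elim=> {F F'} [F F'|//|F F' F'' _ -> _ -> //].
rewrite /num_of_type; case=> [s t g h|s t g h|h F''].
- by rewrite !count_cat /= tE; lia.
- by have := tE h^-1 g; rewrite !count_cat /= invgK => ->; lia.
- by rewrite count_map; apply: eq_count => g /=; rewrite tE.
Qed.

(** * Factorizations as lists of vectors and exponents *)

Definition encodes (f : B3) (e : entry) : Prop :=
  (1 <= e.2 <= 2)%nat /\
  exists2 g, f = (g * sigma1 * g^-1) ^+ e.2 & e.1 = vact g e1.

Lemma encodes_inj f f' e : encodes f e -> encodes f' e -> f = f'.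
Proof.
by move=> [_ [g -> ge]] [_ [g' -> g'e]]; rewrite !half_twist_vactE -ge -g'e.
Qed.

Lemma encodes_oppv f v n : encodes f (v, n) -> encodes f (oppv v, n).
Proof.
move=> [n12 [g /= -> ->]]; split=> //; exists (g * Delta ^+ 2) => /=.
  have := Delta2_commute sigma1; move: (Delta ^+ 2) => z; rewrite /commute => zC.
  by rewrite invgM -(mulgA g z) -zC !mulgA mulgK.
by rewrite vactM vact_Delta2 vact_opp.
Qed.

Lemma encodes_normv f v n : encodes f (v, n) -> encodes f (normv v, n).
Proof. by rewrite /normv; case: ifP => // _; exact: encodes_oppv. Qed.

Lemma encodes_conj h f v n :
  encodes f (v, n) -> encodes (h * f * h^-1) (vact h v, n).
Proof.
move=> [n12 [g /= -> ->]]; split=> //; exists (h * g) => /=; last by rewrite vactM.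
have -> : h * g * sigma1 * (h * g)^-1 = (g * sigma1 * g^-1) ^ h^-1.
  by rewrite /conjg invgK invgM !mulgA.
by rewrite -conjXg /conjg invgK mulgA.
Qed.

Lemma encodes_vact f e w :
  encodes f e -> vact f w = transvection e.1 (Z.of_nat e.2) w.
Proof. by move=> [_ [g -> ->]]; rewrite vact_twist. Qed.

Lemma encodes_vactV f e w :
  encodes f e -> vact f^-1 w = transvection e.1 (- Z.of_nat e.2) w.
Proof.
move=> fe; rewrite -[in LHS](transvectionK e.1 (Z.of_nat e.2) w).
by rewrite -(encodes_vact _ fe) vactK.
Qed.

Lemma encodes_has_type f e : encodes f e -> has_type e.2 f.
Proof.
by move=> [_ [g -> _]]; exists (g * sigma1 * g^-1) => //; exists g.
Qed.

Lemma encodes_degree f e : encodes f e -> degree f = Z.of_nat e.2.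
Proof. by move/encodes_has_type/degree_type. Qed.

Lemma encodes_num f e n : encodes f e -> `[< has_type n f >] = (e.2 == n).
Proof.
move=> fe; apply/asboolP/eqP => [|<-]; last exact: encodes_has_type.
by move/degree_type; rewrite (encodes_degree fe); lia.
Qed.

Lemma encodes_primitive f e : encodes f e -> exists w, det e.1 w = 1%Z.
Proof. by move=> [_ [g _ ->]]; exists (vact g e2); rewrite det_vact. Qed.

Lemma encodes_turns_left f e : encodes f e -> turns_left f.
Proof.
by move=> [_ [g -> _]]; apply/turns_leftX/turns_left_conj/turns_left_sigma1.
Qed.

Lemma encodes_exists f : has_type 1 f \/ has_type 2 f -> exists e, encodes f e.
Proof.
have aux n : (1 <= n <= 2)%nat -> has_type n f -> exists e, encodes f e.
  by move=> n12 [_ [g ->] fE]; exists (vact g e1, n); split=> //; exists g.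
by case; exact: aux.
Qed.

Definition seq_encodes (F : seq B3) (c : seq entry) : Prop :=
  List.Forall2 encodes F c.

Lemma seq_encodes_inj F F' c : seq_encodes F c -> seq_encodes F' c -> F = F'.
Proof.
move=> Fc; elim: Fc F' => {F c} [|f e F c fe _ IHF] F' F'c; inversion F'c => //.
by subst; congr (_ :: _); [exact: encodes_inj fe _ | exact: IHF].
Qed.

Lemma seq_encodes_normc F c : seq_encodes F c -> seq_encodes F (normc c).
Proof.
elim=> {F c} [|f [v n] F c fe _ IHF]; constructor=> //; exact: encodes_normv.
Qed.

Lemma seq_encodes_conj h F c : seq_encodes F c ->
  seq_encodes [seq h * f * h^-1 | f <- F] [seq (vact h e.1, e.2) | e <- c].
Proof.
elim=> {F c} [|f [v n] F c fe _ IHF]; constructor=> //; exact: encodes_conj.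
Qed.

Lemma seq_encodes_num F c n :
  seq_encodes F c -> num_of_type n F = count (fun e => e.2 == n) c.
Proof.
elim=> {F c} //= f e F c fe _ IHF.
by rewrite /num_of_type /= (encodes_num n fe) -IHF.
Qed.

Lemma seq_encodes_degree F c :
  seq_encodes F c -> degree (\prod_(f <- F) f) = Z.of_nat (weight c).
Proof.
elim=> {F c} [|f e F c fe _ IHF] /=; first by rewrite big_nil degree1.
by rewrite big_cons degreeM IHF (encodes_degree fe) /weight /=; lia.
Qed.

Lemma seq_encodes_vact F c w : seq_encodes F c ->
  vact (\prod_(f <- F) f) w
    = foldr (fun e w => transvection e.1 (Z.of_nat e.2) w) w c.
Proof.
elim=> {F c} [|f e F c fe _ IHF] /=; first by rewrite big_nil vact1.
by rewrite big_cons vactM IHF (encodes_vact _ fe).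
Qed.

Lemma seq_encodes_turns_left F c :
  seq_encodes F c -> turns_left (\prod_(f <- F) f).
Proof.
elim=> {F c} [|f e F c fe _ IHF]; first by rewrite big_nil; exact: turns_left1.
by rewrite big_cons; apply: turns_leftM => //; exact: encodes_turns_left fe.
Qed.

Lemma seq_encodes_closes F c :
  factorization (Delta ^+ 2) F -> seq_encodes F c -> closes c.
Proof.
move=> FD Fc; rewrite /closes -!(seq_encodes_vact _ Fc) -FD !vact_Delta2.
by rewrite !eqxx.
Qed.

(** * Soundness of the moves on lists *)

(** A Hurwitz move without global conjugation; unlike [hurwitz_step] it can be
  carried out in the tail of a longer list. *)
Definition pair_step (F F' : seq B3) : Prop :=
  exists s t g h, F = s ++ [:: g, h & t] /\
    (F' = s ++ [:: g * h * g^-1, g & t] \/ F' = s ++ [:: h, h^-1 * g * h & t]).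

Lemma pair_step_hurwitz F F' : pair_step F F' -> hurwitz_equiv F F'.
Proof.
move=> [s [t [g [h [-> [] ->]]]]]; apply: rt_step.
  exact: hurwitz_left.
exact: hurwitz_right.
Qed.

Lemma hurwitz_moves_sound F c d : seq_encodes F c -> d \in hurwitz_moves c ->
  exists2 F', seq_encodes F' d & pair_step F F'.
Proof.
move=> Fc; elim: Fc d => {F c} [|f e F c fe Fc IHF] d //=.
case: Fc IHF => [|f' e' F' c' fe' Fc'] IHF //.
rewrite !inE => /or3P[/eqP->|/eqP->|/mapP[d' d'c ->]].
- exists (f * f' * f^-1 :: f :: F');
    last by exists [::], F', f, f'; split=> //; left.
  constructor; last by constructor.
  rewrite -(encodes_vact _ fe); case: e' fe' {IHF} => v n; exact: encodes_conj.
- exists (f' :: f'^-1 * f * f' :: F');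
    last by exists [::], F', f, f'; split=> //; right.
  constructor=> //; constructor=> //.
  rewrite -(encodes_vactV _ fe') -{2}(invgK f').
  by case: e fe {IHF} => v n; exact: encodes_conj.
- have [F2 F2d' [s [t [g [h [FE F2E]]]]]] := IHF _ d'c.
  exists (f :: F2); first by constructor.
  exists (f :: s), t, g, h; rewrite FE; split=> //.
  by case: F2E => ->; [left|right].
Qed.

Lemma conj_moves_sound F c d : seq_encodes F c -> d \in conj_moves c ->
  exists2 F', seq_encodes F' d & hurwitz_equiv F F'.
Proof.
move=> Fc /mapP[x _ ->]; pose h := B3_of_word [:: x].
exists [seq h * f * h^-1 | f <- F]; last by apply: rt_step; exact: hurwitz_conj.
have := seq_encodes_conj h Fc; congr seq_encodes.
by apply: eq_map => e; rewrite /vact (act_letter vstepP).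
Qed.

Lemma best_move_sound F c : seq_encodes F c ->
  exists2 F', seq_encodes F' (best_move c) & hurwitz_equiv F F'.
Proof.
move=> Fc; have : best_move c \in c :: map normc (hurwitz_moves c ++ conj_moves c).
  rewrite /best_move; elim: (map _ _) => [|d s IHs] /=; first exact: mem_head.
  case: ifP => _; first by rewrite !inE eqxx orbT.
  by move: IHs; rewrite !inE => /orP[->|->]; rewrite ?orbT.
rewrite inE => /orP[/eqP->|/mapP[d]]; first by exists F => //; exact: hurwitz_refl.
rewrite mem_cat => /orP[dc|dc] ->.
  have [F' F'd] := hurwitz_moves_sound Fc dc.
  by exists F'; [exact: seq_encodes_normc|exact: pair_step_hurwitz].
have [F' F'd] := conj_moves_sound Fc dc.
by exists F' => //; exact: seq_encodes_normc.
Qed.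

Lemma normal_form_sound F c : seq_encodes F c ->
  exists2 F', seq_encodes F' (normal_form c) & hurwitz_equiv F F'.
Proof.
rewrite /normal_form => Fc; elim: 10 => [|k [F1 F1c FF1]].
  by exists F => //; exact: hurwitz_refl.
have [F2 F2c F1F2] := best_move_sound F1c.
by exists F2 => //; exact: hurwitz_trans F1F2.
Qed.

(** Both factorizations are equivalent to one encoded by the common normal form,
  and that list encodes only one factorization. *)
Lemma normal_form_equiv F F' c c' : seq_encodes F c -> seq_encodes F' c' ->
  normal_form c = normal_form c' -> hurwitz_equiv F F'.
Proof.
move=> /normal_form_sound[F1 F1c FF1] /normal_form_sound[F2 F2c FF2] cc'.
rewrite -cc' in F2c; rewrite (seq_encodes_inj F1c F2c) in FF1.
by apply: hurwitz_trans FF1 _; exact: hurwitz_sym.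
Qed.

Lemma seq_encodes_standard i :
  (i < 4)%nat -> seq_encodes (nth [::] standard_factorizations i)
                           (nth [::] standard_codes i).
Proof.
have s1 n : (1 <= n <= 2)%nat -> encodes (sigma1 ^+ n) (e1, n).
  by split=> //; exists 1; rewrite ?vact1 // mul1g invg1 mulg1.
have s2 n : (1 <= n <= 2)%nat -> encodes (sigma2 ^+ n) (e2, n).
  split=> //; exists Delta; last by rewrite vact_Delta.
  by rewrite -sigma2_Delta mulgK.
have s11 := s1 1%nat isT; have s12 := s1 2 isT.
have s21 := s2 1%nat isT; have s22 := s2 2 isT.
have s3 : encodes (sigma1^-1 * sigma2 ^+ 2 * sigma1) ((1, 1)%Z, 2).
  have := encodes_conj sigma1^-1 s22; rewrite invgK.
  suff -> : vact sigma1^-1 e2 = (1, 1)%Z by [].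
  by rewrite -(vactK sigma1 (1, 1)%Z) vact_sigma1.
case: i => [|[|[|[|i]]]] i4; [| | | |by lia];
  by rewrite /seq_encodes /=;
    do ![apply: List.Forall2_nil | apply: List.Forall2_cons => //].
Qed.

(** * Reduction to the finite check *)

Lemma seq_encodes_exists F :
  (forall f, f \in F -> has_type 1 f \/ has_type 2 f) ->
  exists c, seq_encodes F c.
Proof.
elim: F => [|f F IHF] FP; first by exists [::]; constructor.
have [c Fc] := IHF (fun g gF => FP g (mem_behead (s := f :: F) gF)).
have [e fe] := encodes_exists (FP f (mem_head f F)).
by exists (e :: c); constructor.
Qed.

Lemma seq_encodes_mem F c e : seq_encodes F c -> e \in c -> exists f, encodes f e.
Proof.
elim=> {F c} [//|f d F c fd _ IHF]; rewrite inE => /orP[/eqP->|/IHF//].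
by exists f.
Qed.

Lemma seq_encodes_cat F c d : seq_encodes F (c ++ d) ->
  exists F1 F2, [/\ F = F1 ++ F2, seq_encodes F1 c & seq_encodes F2 d].
Proof. by move=> /List.Forall2_app_inv_r[F1 [F2 [? [? ?]]]]; exists F1, F2. Qed.

Lemma seq_encodes_cons F e c : seq_encodes F (e :: c) ->
  exists f F', [/\ F = f :: F', encodes f e & seq_encodes F' c].
Proof. by move=> Fec; inversion Fec; subst; exists x, l. Qed.

(** The bound on two factors of a factorization of [Delta^2]. *)
Definition compatible (e d : entry) : Prop :=
  (Z.of_nat e.2 * Z.of_nat d.2 * det e.1 d.1 ^ 2 <= 4)%Z.

(** The product [P x Q y T] is central, so it equals
  [x y (y^-1 Q y) T P], to which [twist_pair_bound] applies. *)
Lemma seq_encodes_compatible F p e q d t :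
  factorization (Delta ^+ 2) F -> seq_encodes F (p ++ e :: q ++ d :: t) ->
  compatible e d.
Proof.
move=> FD /seq_encodes_cat[P [X [FE Pp]]].
move=> /seq_encodes_cons[x [Y [XE xe]]].
move=> /seq_encodes_cat[Q [Z [YE Qq]]].
move=> /seq_encodes_cons[y [T [ZE yd Tt]]].
move: FD; rewrite /factorization FE XE YE ZE !(big_cat, big_cons) /=.
have := seq_encodes_turns_left Pp; have := seq_encodes_turns_left Qq.
have := seq_encodes_turns_left Tt.
move: (\prod_(_ <- P) _) (\prod_(_ <- Q) _) (\prod_(_ <- T) _)
  => P' Q' T' T'P Q'P P'P.
case: xe yd => [_ [g -> ge]] [_ [h -> he]];
set x' := (g * sigma1 * g^-1) ^+ _; set y' := (h * sigma1 * h^-1) ^+ _ => D.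
rewrite /compatible ge he.
apply: (@twist_pair_bound g h _ _ (y'^-1 * Q' * y' * T' * P')).
  rewrite -mulgA; apply: turns_leftM; last exact: turns_leftM.
  by rewrite -{2}(invgK y'); exact: turns_left_conj.
rewrite -/x' -/y'; have := Delta2_commute P'.
rewrite /commute D -(mulgA P') => /mulgI ->.
by rewrite !mulgA mulgK.
Qed.

(** Powers of [sigma1] are the braids used to normalize the second vector while
  keeping the first one, [e1]. *)
Lemma shear_exists j : exists h, forall p q, vact h (p, q) = (p - j * q, q)%Z.
Proof.
have shear k p q : vact (sigma1 ^+ k) (p, q) = (p - Z.of_nat k * q, q)%Z.
  elim: k => [|k IHk]; first by rewrite vact1; congr (_, _); lia.
  rewrite expgS vactM IHk vact_sigma1; congr (_, _).
  by rewrite Nat2Z.inj_succ; ring.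
case: (Z.le_gt_cases 0 j) => j0.
  by exists (sigma1 ^+ Z.to_nat j) => p q; rewrite shear Z2Nat.id.
exists (sigma1 ^+ Z.to_nat (- j))^-1 => p q.
rewrite -[RHS](vactK (sigma1 ^+ Z.to_nat (- j))) shear Z2Nat.id; last by lia.
by congr (vact _ (_, _)); lia.
Qed.

(** The bound leaves [q = 1, -1, 2, -2], and [p] can be changed by multiples of
  [q]; it is odd when [q] is even, the vector being primitive. *)
Lemma normv_fronts p q n m :
  (1 <= n <= 2)%nat -> (1 <= m <= 2)%nat -> q <> 0%Z ->
  compatible (e1, n) ((p, q), m) -> (exists w, det (p, q) w = 1%Z) ->
  exists j, [:: (e1, n); (normv (p - j * q, q)%Z, m)] \in fronts.
Proof.
rewrite /compatible /det /e1 /= => n12 m12 q0 nmq [[a b] /= prim].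
have {}n12 : n = 1%nat \/ n = 2 by lia.
have {}m12 : m = 1%nat \/ m = 2 by lia.
have q4 : (q ^ 2 <= 4)%Z by case: n12 m12 nmq => -> [] ->; lia.
have : (q = 1 \/ q = -1 \/ q = 2 \/ q = -2)%Z by nia.
case=> [q1|[q1|[q1|q1]]]; rewrite {}q1 in prim nmq *.
- exists p; have -> : (p - p * 1 = 0)%Z by lia.
  by case: n12 m12 => -> [] ->.
- exists (- p)%Z; have -> : (p - - p * -1 = 0)%Z by lia.
  by case: n12 m12 => -> [] ->.
- case: (Z.Even_or_Odd p) => -[k pk]; rewrite {}pk in prim nmq *; first by lia.
  exists k; have -> : (2 * k + 1 - k * 2 = 1)%Z by lia.
  by case: n12 m12 nmq => -> [] -> //; lia.
- case: (Z.Even_or_Odd p) => -[k pk]; rewrite {}pk in prim nmq *; first by lia.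
  exists (- k - 1)%Z; have -> : (2 * k + 1 - (- k - 1) * -2 = -1)%Z by lia.
  by case: n12 m12 nmq => -> [] -> //; lia.
Qed.

(** If all vectors were parallel to that of the first factor, all factors would
  fix it, whereas [Delta^2] maps it to its opposite. *)
Lemma moves_to_front F : factorization (Delta ^+ 2) F ->
  (forall f, f \in F -> has_type 1 f \/ has_type 2 f) ->
  exists F' a b r, [/\ hurwitz_equiv F F', seq_encodes F' [:: a, b & r],
    a.1 = e1 & b.1.2 <> 0%Z].
Proof.
move=> FD /seq_encodes_exists[[|[v n] c] Fc].
  have := seq_encodes_degree Fc; rewrite -FD degree_Delta2 /=; lia.
have [f [F0 [FE fv F0c]]] := seq_encodes_cons Fc.
have [u vu] := encodes_primitive fv; rewrite /= in vu.
have /hasP[d dc vd] : has (fun d => ~~ (det v d.1 =? 0)%Z) c.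
  apply: contraT => /hasPn vc0; exfalso.
  have fixv : foldr (fun e w => transvection e.1 (Z.of_nat e.2) w) v c = v.
    elim: c vc0 {Fc F0c} => //= d c IHc vc0.
    rewrite IHc => [|d' d'c]; last by apply: vc0; rewrite inE d'c orbT.
    have := vc0 d (mem_head _ _); case: Z.eqb_spec => //= vd _.
    rewrite /transvection /addZ; move: vd; rewrite /det.
    case: (d.1) v {vu fv IHc vc0} => a b [x y] /= vd.
    by have -> : (a * y - b * x = 0)%Z; [lia|congr (_, _); lia].
  have := seq_encodes_vact v Fc; rewrite -FD vact_Delta2 /= fixv.
  move: vu; rewrite /oppv /transvection /addZ /det.
  case: v {fv fixv vc0 Fc} => x y /= vu.
  case; nia.
case/splitPr: dc => [q t] in F0c.
have [Q [Y [F0E Qq]]] := seq_encodes_cat F0c.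
move=> /seq_encodes_cons[y [T [YE yd Tt]]].
have [_ [g _ /= vg]] := fv.
pose F1 := f :: y :: [seq y^-1 * x * y | x <- Q] ++ T.
have FF1 : hurwitz_equiv F F1.
  by rewrite FE F0E YE; exact: (hurwitz_to_front [:: f]).
have [r F1r] : exists r, seq_encodes F1 [:: (v, n), d & r].
  exists ([seq (vact y^-1 e.1, e.2) | e <- q] ++ t).
  constructor=> //; constructor=> //.
  apply: List.Forall2_app => //.
  have := seq_encodes_conj y^-1 Qq; congr seq_encodes.
  by apply: eq_map => x; rewrite invgK.
exists [seq g^-1 * x * g^-1^-1 | x <- F1], (vact g^-1 v, n), (vact g^-1 d.1, d.2),
  [seq (vact g^-1 e.1, e.2) | e <- r]; split=> //=.
- by apply: hurwitz_trans FF1 _; apply: rt_step; exact: hurwitz_conj.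
- by have := seq_encodes_conj g^-1 F1r.
- by rewrite vg vactK.
- have := det_vact g^-1 v d.1; rewrite vg vactK -vg {1}/det /e1 /=.
  case: Z.eqb_spec vd => //= vd _.
  by move: (vact _ _) (det v d.1) vd => [x z] D /= D0; lia.
Qed.

Lemma moves_to_fronts F : factorization (Delta ^+ 2) F ->
  (forall f, f \in F -> has_type 1 f \/ has_type 2 f) ->
  exists F' a b r, [/\ hurwitz_equiv F F', seq_encodes F' [:: a, b & r] &
    [:: a; b] \in fronts].
Proof.
move=> FD FP.
have [F1 [[v n] [[[p q] m] [r [FF1 F1c /= v1 q0]]]]] := moves_to_front FD FP.
rewrite {}v1 in F1c.
have F1D := hurwitz_factorization (@Delta2_commute) FF1 FD.
have [f1 f1e] := seq_encodes_mem F1c (mem_head _ _).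
have [f2 f2e] : exists f, encodes f ((p, q), m).
  by apply: seq_encodes_mem F1c _; rewrite !inE eqxx orbT.
have compat := seq_encodes_compatible (p := [::]) (q := [::]) F1D F1c.
have [j jP] := normv_fronts f1e.1 f2e.1 q0 compat (encodes_primitive f2e).
have [h hP] := shear_exists j.
exists [seq h * f * h^-1 | f <- F1], (e1, n), (normv (p - j * q, q)%Z, m),
  (normc [seq (vact h e.1, e.2) | e <- r]); split=> //.
  by apply: hurwitz_trans FF1 _; apply: rt_step; exact: hurwitz_conj.
have := seq_encodes_normc (seq_encodes_conj h F1c).
by rewrite /= !hP; have -> : (1 - j * 0 = 1)%Z by lia.
Qed.

(** The bound against [e1] limits [q], and the bound against the second vector
  limits [p] or [q - 2 p]; the vector is primitive. *)
Lemma box_normv f e a b : [:: a; b] \in fronts -> encodes f e ->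
  compatible a e -> compatible b e -> (normv e.1, e.2) \in box.
Proof.
move=> ab [n12 fe]; have {fe} := encodes_primitive (conj n12 fe).
case: e n12 => [[p q] n] /= n12 [[u w]]; rewrite /det /= => prim ca cb.
have {}n12 : n = 1%nat \/ n = 2 by lia.
have [q4 p4] : (Z.of_nat n * q ^ 2 <= 4 /\
    (Z.of_nat n * p ^ 2 <= 4 \/ Z.of_nat n * (q - 2 * p) ^ 2 <= 4))%Z.
  move: ab ca cb; rewrite /compatible /det !inE.
  by do ![case/orP] => /eqP[-> ->] /=; case: n12 => ->; lia.
have q2 : (q = -2 \/ q = -1 \/ q = 0 \/ q = 1 \/ q = 2)%Z.
  by case: n12 q4 => ->; nia.
have p2 : (p = -2 \/ p = -1 \/ p = 0 \/ p = 1 \/ p = 2)%Z.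
  case: p4 => p4; first by case: n12 p4 => ->; nia.
  have : (-2 <= q - 2 * p <= 2)%Z.
    by move: (q - 2 * p)%Z p4 => w0 p4; case: n12 p4 => ->; nia.
  by lia.
move: prim q4 p4 {ca cb ab}.
by case: n12 => ->; do 4?[case: q2 => [->|q2]]; rewrite ?q2;
  do 4?[case: p2 => [->|p2]]; rewrite ?p2 => prim q4 p4 //; exfalso; lia.
Qed.

Lemma codesP k c : all (mem box) c -> (weight c <= k)%nat ->
  c \in codes k (weight c).
Proof.
have box_gt0 : all (fun e : entry => 0 < e.2)%nat box by [].
elim: k c => [|k IHk] [|[v n] c] // /andP[ebox cbox];
  have /= n0 := allP box_gt0 _ ebox;
  rewrite (_ : weight _ = n + weight c)%nat // => ck; first by lia.
case E : (n + weight c)%nat => [|w]; first by lia.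
have en : (v, n) \in [seq e : entry <- box | e.2 <= w.+1]%nat.
  by rewrite mem_filter; apply/andP; split=> //=; lia.
have cn : c \in codes k (w.+1 - (v, n).2).
  rewrite /=; have -> : (w.+1 - n = weight c)%nat by lia.
  by apply: IHk => //; lia.
by apply/allpairsPdep; exists (v, n), c; exact: And3 en cn erefl.
Qed.

Lemma hurwitz_standard F : factorization (Delta ^+ 2) F ->
  (forall f, f \in F -> has_type 1 f \/ has_type 2 f) ->
  exists2 i, (i < 4)%nat & hurwitz_equiv F (nth [::] standard_factorizations i).
Proof.
move=> FD FP; have [F1 [a [b [r [FF1 F1c ab]]]]] := moves_to_fronts FD FP.
have F1D := hurwitz_factorization (@Delta2_commute) FF1 FD.
pose c := [:: a, b & normc r].
have F1c' : seq_encodes F1 c.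
  have := seq_encodes_normc F1c; congr seq_encodes.
  move: ab; rewrite /c /= !inE.
  by do ![case/orP] => /eqP[-> ->].
have rbox : all (mem box) (normc r).
  apply/allP => _ /mapP[e er ->]; rewrite inE.
  have [f fe] : exists f, encodes f e.
    by apply: seq_encodes_mem F1c _; rewrite !inE er !orbT.
  case/splitPr: er F1c => [r1 r2] F1c.
  apply: (box_normv ab fe).
    exact: (seq_encodes_compatible (p := [::]) (q := b :: r1) F1D F1c).
  exact: (seq_encodes_compatible (p := [:: a]) (q := r1) F1D F1c).
have cnf : normal_form c \in normal_codes.
  apply: (allP normal_form_candidates); rewrite mem_filter.
  rewrite (seq_encodes_closes F1D F1c') /=.
  have := seq_encodes_degree F1c'; rewrite -F1D degree_Delta2 => c6.
  apply/flattenP; exists [seq [:: a; b] ++ s | s <- codes 4 (6 - weight [:: a; b])].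
    by apply/mapP; exists [:: a; b].
  apply: map_f; rewrite (_ : (_ - _)%nat = weight (normc r)); last first.
    by move: c6; rewrite /c /weight /=; lia.
  apply: codesP => //.
  have [f1 f1a] := seq_encodes_mem F1c (mem_head _ _).
  have [f2 f2b] : exists f, encodes f b.
    by apply: seq_encodes_mem F1c _; rewrite !inE eqxx orbT.
  by move: c6 (f1a.1) (f2b.1); rewrite /c /weight /=; lia.
have i4 : (index (normal_form c) normal_codes < 4)%nat by rewrite index_mem.
exists (index (normal_form c) normal_codes) => //.
apply: hurwitz_trans FF1 _.
apply: normal_form_equiv F1c' (seq_encodes_standard i4) _.
by rewrite -(nth_map [::] [::]) // normal_form_standard nth_index.
Qed.

Unset Implicit Arguments.
Set Strict Implicit.

Theorem theorem4p39 (F : seq B3)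
    (F_Delta2 : factorization (Delta ^+ 2) F)
    (F_types : forall g : B3, g \in F -> has_type 1 g \/ has_type 2 g) :
  exists S : seq B3,
    [/\ unique (standard_of_same_types F) S,
        factorization (Delta ^+ 2) S
      & hurwitz_equiv F S].
Proof.
have [i i4 FS] := hurwitz_standard F_Delta2 F_types.
exists (nth [::] standard_factorizations i); split=> //; last first.
  exact: hurwitz_factorization Delta2_commute FS F_Delta2.
have num1 k : (k < 4)%nat ->
    num_of_type 1 (nth [::] standard_factorizations k) = (6 - 2 * k)%nat.
  move=> k4; rewrite (seq_encodes_num 1 (seq_encodes_standard k4)).
  by case: k k4 => [|[|[|[|k]]]].
split.
  by split; [exact: mem_nth | | ]; rewrite (hurwitz_num_of_type _ FS).
move=> S [/(nthP [::])[k k4 <-]]; rewrite (hurwitz_num_of_type _ FS).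
rewrite !num1 // => ik _.
by congr nth; move: k4; rewrite /= in ik *; lia.
Qed.
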